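(* (1) Let $(Y_0,Y_1)$ be an arbitrary pair of real random variables and let $Y$ and $D\in\{0,1\}$ satisfy $Y=Y_1D+Y_0(1-D)$ and almost surely $Y_1>Y_0\Rightarrow D=1$, $Y_1<Y_0\Rightarrow D=0$. Then the distribution functions $F_0,F_1$ of $Y_0,Y_1$ satisfy $$F_d(y_2)-F_d(y_1)\ge \mathbb P(y_1<Y\le y_2,D=d)+\mathbb P(Y\le y_2,D=1-d)\,1\{y_1=-\infty\}\qquad(\ast)$$ for $d=0,1$ and all $y_1,y_2\in\mathbb R\cup\{\pm\infty\}$ with $y_1<y_2$. (2) Conversely, let $Y$ be an arbitrary real random variable and $D$ a binary random variable, and let $F_0,F_1$ be right-continuous functions satisfying $(\ast)$ for $d=0,1$ and all $y_1<y_2$ in $\mathbb R\cup\{\pm\infty\}$. Then there exist, on some probability space, random variables $(\tilde Y,\tilde D,Y_0,Y_1)$ with $(\tilde Y,\tilde D)$ distributed as $(Y,D)$, $Y_0$ and $Y_1$ having distribution functions $F_0$ and $F_1$ respectively, $\tilde Y=Y_1\tilde D+Y_0(1-\tilde D)$, and almost surely $Y_1>Y_0\Rightarrow\tilde D=1$, $Y_1<Y_0\Rightarrow\tilde D=0$.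
   Context: For a function $F$ on $\mathbb R$, $F(\pm\infty)$ denotes the limits at $\pm\infty$; for $y_1=-\infty$ the event $\{y_1<Y\le y_2\}$ is $\{Y\le y_2\}$, and for $y_2=+\infty$ the event $\{Y\le y_2\}$ is the whole space.
   Formalization: In part (2) F_0 and F_1 are additionally assumed to tend to 0 at −∞ and to 1 at +∞; without this the claim fails (e.g. adding 5 to F_d preserves (∗) and right-continuity), and the conclusion forces it. *)

(* Defs.v *)
From HB Require Import structures.
From mathcomp Require Import all_boot all_order all_algebra.
From mathcomp Require Import all_classical all_reals all_analysis.
Set Implicit Arguments. Unset Strict Implicit. Unset Printing Implicit Defensive.
Import Order.TTheory GRing.Theory Num.Theory.
Import numFieldNormedType.Exports.
Local Open Scope classical_set_scope.
Local Open Scope ring_scope.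

Definition Fext (R : realType) (F : R -> \bar R) (y : \bar R) : \bar R :=
  match y with
  | EFin r => F r
  | +oo%E => lim (F x @[x --> +oo])
  | -oo%E => lim (F x @[x --> -oo])
  end.

(* The inequality (star) for a given d, F, and (Y, D) on (T, P), at (y1, y2):
   F(y2) - F(y1) >= P(y1 < Y <= y2, D = d) + P(Y <= y2, D = 1 - d) 1{y1 = -oo}.
   Events are written with extended reals, so that y1 = -oo gives {Y <= y2}
   and y2 = +oo gives no upper constraint. *)
Definition ineq_star d (T : measurableType d) (R : realType)
  (P : probability T R) (Y D : T -> R) (dd : R) (F : R -> \bar R)
  (y1 y2 : \bar R) : Prop :=
  (P [set x | (y1 < (Y x)%:E)%E /\ ((Y x)%:E <= y2)%E /\ D x = dd%R]
   + (y1 == -oo)%E%:R%:E * P [set x | ((Y x)%:E <= y2)%E /\ D x = (1 - dd)%R]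
   <= Fext F y2 - Fext F y1)%E.

(* Main.v *)
(* The event [D = b%:R] is encoded by a boolean [b], and [Y_b] is the potential
   outcome observed on it; the selection rule says that the observed outcome is
   almost surely the larger one.

   For (1), [Y = Y_b] on [D = b] and [Y_b <= Y] almost surely on [D = 1 - b], so
   the events on the left of (star) are almost surely contained in
   [y1 < Y_b <= y2].

   For (2), write [J_b y = P(Y <= y, D = b)]. If [Y_a] is to have distribution
   function [F_a], then [P(Y_a <= y, D = b)] has to be [J_a y] for [b = a] and
   [K_a y = F_a y - J_a y] for [b = 1 - a]. Inequality (star) at finite points
   says that [K_a] is nondecreasing, i.e. that it is the distribution function
   of a measure of mass [P(D = 1 - a)], and (star) at [y1 = -oo] says that
   [J_(1 - a) <= K_a]. On [D = b], represented by an interval of length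
   [P(D = b)], take for both outcomes the quantile functions of these
   distribution functions: quantiles decrease when the distribution function
   increases, so that the unobserved outcome is the smaller one. *)
Require Import Defs.
From HB Require Import structures.
From mathcomp Require Import all_boot all_order all_algebra.
From mathcomp Require Import all_classical all_reals all_analysis.
From mathcomp Require Import measurable_realfun lra.
Set Implicit Arguments. Unset Strict Implicit. Unset Printing Implicit Defensive.
Import Order.TTheory GRing.Theory Num.Theory.
Import numFieldNormedType.Exports.
Local Open Scope classical_set_scope.
Local Open Scope ring_scope.

Section quantile.
Context {R : realType}.
Implicit Types (l r u y : R).

Lemma cumulativeBounded_itv l r (G : cumulativeBounded l r) y : l <= G y <= r.
Proof.
apply/andP; split.
  apply: (cvgr_to_le (cumulativeNy G)); near=> x.
  by apply: cumulative_is_nondecreasing; near: x; exact: nbhs_ninfty_le.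
apply: (cvgr_to_ge (cumulativey G)); near=> x.
by apply: cumulative_is_nondecreasing; near: x; exact: nbhs_pinfty_ge.
Unshelve. all: by end_near. Qed.

(* The value outside of [`]l, r[] is junk; that it does not depend on [G] makes
   [quantile_anti] hold for every [u]. *)
Definition quantile l r (G : cumulativeBounded l r) u : R :=
  if l < u < r then inf [set y | u <= G y] else 0.

Lemma quantile_le l r (G : cumulativeBounded l r) u y : l < u < r ->
  (quantile G u <= y) = (u <= G y).
Proof.
move=> lur; rewrite /quantile lur; case/andP: lur => lu ur.
set E := [set z | u <= G z].
have ndG : nondecreasing G := cumulative_is_nondecreasing G.
have E_nonempty : E !=set0.
  have /filter_ex[z uGz] : \forall x \near +oo, u <= G x.
    exact: cvgr_ge (cumulativey G) _ ur.
  by exists z.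
have [z0 Gz0] : exists z, G z < u.
  have /filter_ex[z Gzu] : \forall x \near -oo, G x < u.
    exact: cvgr_lt (cumulativeNy G) _ lu.
  by exists z.
have E_lbound : has_lbound E.
  exists z0 => z uGz; rewrite leNgt; apply/negP => /ltW/ndG Gzz0.
  by have := le_lt_trans (le_trans uGz Gzz0) Gz0; rewrite ltxx.
apply/idP/idP => [Ey|uGy]; last exact: ge_inf.
suff inf_attained : u <= G (inf E).
  by apply: (le_trans inf_attained); exact: ndG.
apply: (cvgr_to_ge (cumulative_is_right_continuous G (inf E))); near=> x.
have x_inf : 0 < x - inf E by rewrite subr_gt0; near: x; exact: nbhs_right_gt.
have [z uGz zx] := inf_adherent x_inf (conj E_nonempty E_lbound).
by apply: (le_trans uGz); apply: ndG; rewrite ltW// (lt_le_trans zx)// subrKC.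
Unshelve. all: by end_near. Qed.

Lemma quantile_anti l r (G G' : cumulativeBounded l r) u :
  (forall y, G y <= G' y) -> quantile G' u <= quantile G u.
Proof.
move=> GG'; have [lur|/negbTE nlur] := boolP (l < u < r).
  by rewrite quantile_le// (le_trans _ (GG' _))// -(quantile_le G).
by rewrite /quantile nlur.
Qed.

Lemma measurable_quantile l r (G : cumulativeBounded l r) :
  measurable_fun [set: R] (quantile G).
Proof.
have -> : quantile G = quantile G \_ `]l, r[.
  apply/funext => u; rewrite patchE mem_setE in_itv/=.
  by case: ifPn => // /negbTE nlur; rewrite /quantile nlur.
apply: (measurable_restrictT _ (measurable_itv _)).1 => mlr.
apply: (measurability _ (RGenOInfty.measurableE R)) => //.
move=> _ [_ [y ->] <-].
rewrite (_ : _ `&` _ = `]l, r[ `&` `]G y, +oo[); first exact: measurableI.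
apply/seteqP; split=> u /= [lur yu]; split=> //; move: lur yu.
  by rewrite !in_itv/= !andbT => lur; rewrite ltNge quantile_le// -ltNge.
by rewrite !in_itv/= !andbT => lur; rewrite [y < _]ltNge quantile_le// -ltNge.
Qed.

Lemma lebesgue_measure_itv_bnd (x y : bool) (a b : R) : a <= b ->
  lebesgue_measure [set` Interval (BSide x a) (BSide y b)] = (b - a)%:E.
Proof.
by move=> ab; rewrite lebesgue_measure_itv -(wlength_itv idfun) wlength_itv_bnd.
Qed.

Lemma lebesgue_quantile_le l r (G : cumulativeBounded l r) y :
  lebesgue_measure ([set u | quantile G u <= y] `&` `]l, r[) = (G y - l)%:E.
Proof.
have /andP[lG] := cumulativeBounded_itv G y.
rewrite le_eqVlt => /predU1P[Gr|Gr].
  rewrite setIidr ?lebesgue_measure_itv_bnd ?Gr -?Gr// => u /=.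
  by rewrite in_itv/= => lur; rewrite quantile_le// Gr ltW//; case/andP: lur.
rewrite -(lebesgue_measure_itv_bnd false false lG).
congr lebesgue_measure; apply/seteqP; split=> u /=; rewrite !in_itv/=.
  by move=> [+ lur]; rewrite quantile_le// => ->; case/andP: lur => ->.
move=> /andP[lu uG].
have lur : l < u < r by rewrite lu (le_lt_trans uG).
by rewrite quantile_le.
Qed.

End quantile.

Section measures.
Context d (T : measurableType d) (R : realType).
Local Open Scope ereal_scope.

Lemma le_measure_ae (mu : {measure set T -> \bar R}) (A B : set T) :
    measurable A -> measurable B -> {ae mu, forall x, A x -> B x} ->
  mu A <= mu B.
Proof.
move=> mA mB [N [mN N0 subN]]; rewrite -(measureU0 mB mN N0).
apply: le_measure; rewrite ?inE//; first exact: measurableU.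
move=> x Ax; have [Bx|nBx] := pselect (B x); [by left|right].
by apply: subN => AB; exact/nBx/AB.
Qed.

Lemma norm_fine_measureIB_le (mu : {finite_measure set T -> \bar R})
    (A B C : set T) :
    measurable A -> measurable B -> measurable C -> A `<=` B ->
  (`|fine (mu (B `&` C)) - fine (mu (A `&` C))| <=
   `|fine (mu B) - fine (mu A)|)%R.
Proof.
move=> mA mB mC AB.
have fineB_setD (U V : set T) : measurable U -> measurable V -> U `<=` V ->
    (fine (mu V) - fine (mu U))%R = fine (mu (V `\` U)).
  move=> mU mV UV; rewrite measureD ?setIidr ?fineB ?fin_num_measure//.
  by rewrite ltey_eq fin_num_measure.
rewrite !fineB_setD//; [|exact: measurableI..|exact: setSI].
have mBA : measurable (B `\` A) := measurableD mB mA.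
have mBAC : measurable ((B `&` C) `\` (A `&` C)).
  by apply: measurableD; exact: measurableI.
rewrite !ger0_norm ?fine_ge0// fine_le ?fin_num_measure//.
apply: le_measure; rewrite ?inE// => x [[Bx Cx] nAC].
by split=> // Ax; exact: nAC.
Qed.

Lemma cvg_fine_measureI (mu : {finite_measure set T -> \bar R})
    (I : Type) (F : set_system I) (FF : Filter F)
    (A : I -> set T) (B C : set T) :
    (forall i, measurable (A i)) -> measurable B -> measurable C ->
    (\forall i \near F, A i `<=` B \/ B `<=` A i) ->
    fine (mu (A i)) @[i --> F] --> fine (mu B) ->
  fine (mu (A i `&` C)) @[i --> F] --> fine (mu (B `&` C)).
Proof.
move=> mA mB mC AB /cvgrPdist_le AcvgB; apply/cvgrPdist_le => e e0.
near=> i; apply: (@le_trans _ _ `|fine (mu B) - fine (mu (A i))|%R).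
  have [AiB|BAi] : A i `<=` B \/ B `<=` A i by near: i.
    exact: norm_fine_measureIB_le.
  by rewrite distrC [leRHS]distrC; exact: norm_fine_measureIB_le.
by near: i; exact: AcvgB.
Unshelve. all: by end_near. Qed.

Lemma bool_mixture_probability (mu : bool -> {measure set T -> \bar R}) :
    mu false setT + mu true setT = 1 ->
  exists P : probability (T * bool)%type R,
    forall (b : bool) E, measurable E -> P (E `*` [set b]) = mu b E.
Proof.
move=> mu1; pose mix : {measure set (T * bool) -> \bar R} :=
  measure_add (mu false \x \d_false) (mu true \x \d_true).
have mixE A : mix A = (mu false \x \d_false) A + (mu true \x \d_true) A.
  exact: measure_addE.
have mix_slice (b : bool) E : measurable E -> mix (E `*` [set b]) = mu b E.
  move=> mE; rewrite mixE !product_measure1E//= !diracE.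
  by case: b; rewrite !in_set1/= mule1 mule0 ?adde0 ?add0e.
have mix1 : mix setT = 1.
  by rewrite mixE -setXTT !product_measure1E//= !diracT !mule1.
by exists (HB.pack_for (probability (T * bool)%type R) (Measure.sort mix)
  (Measure_isProbability.Build _ _ R (Measure.sort mix) mix1)).
Qed.

End measures.

Section measures_on_rays.
Context {R : realType}.
Local Open Scope ereal_scope.

Lemma measure_eq_rays (mu nu : {measure set R -> \bar R}) :
    (forall y : R, mu `]-oo, y]%classic = nu `]-oo, y]%classic) ->
    (forall y : R, mu `]-oo, y]%classic < +oo) ->
  forall A, measurable A -> mu A = nu A.
Proof.
move=> munu mu_fin A mA.
have fin_ocitv (a b : R) : mu `]a, b]%classic < +oo.
  apply: le_lt_trans (mu_fin b).
  by apply: le_measure; rewrite ?inE//; exact: subset_itvr.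
apply: (@measure_unique _ R R (@ocitv R)
  (fun n => `](- n%:R)%R, n%:R%R]%classic) _ _ _ _ mu nu) => //.
- exact: ocitvI.
- by move=> n; exact: is_ocitv.
- exact: bigcup_itvT.
- move=> _ /ocitvP[->|[[a b] /= ab ->]]; first by rewrite !measure0.
  have ray_sub : `]-oo, a] `<=` (`]-oo, b] : set R) by exact/subset_itvl/ltW.
  have ocE : `]a, b]%classic = `]-oo, b] `\` `]-oo, a] :> set R.
    by rewrite -[RHS]setCK setCD setCitvl setUC -[LHS]setCK setCitv.
  have ocitv_rays (m : {measure set R -> \bar R}) : m `]-oo, b]%classic < +oo ->
      m `]a, b]%classic = m `]-oo, b]%classic - m `]-oo, a]%classic.
    by move=> mb_fin; rewrite ocE measureD// setIidr.
  by rewrite !ocitv_rays -?munu.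
Qed.

End measures_on_rays.

Lemma law_eq_rays d d' (T : measurableType d) (T' : measurableType d')
    (R : realType) (mu : {finite_measure set T -> \bar R})
    (nu : {finite_measure set T' -> \bar R})
    (X : {mfun T >-> R}) (X' : {mfun T' >-> R}) (C : set T) (C' : set T') :
    measurable C -> measurable C' ->
    (forall y, mu (X @^-1` `]-oo, y] `&` C) = nu (X' @^-1` `]-oo, y] `&` C')) ->
  forall A, measurable A -> mu (X @^-1` A `&` C) = nu (X' @^-1` A `&` C').
Proof.
move=> mC mC' rays A mA.
rewrite -[LHS]/(pushforward (mrestr mu mC) X A).
rewrite -[RHS]/(pushforward (mrestr nu mC') X' A).
apply: measure_eq_rays => // y; rewrite ltey_eq fin_num_measure//.
exact: measurable_funPTI.
Qed.

Lemma natr_bool_inj (R : numDomainType) : injective (fun b : bool => b%:R : R).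
Proof. by move=> [] [] //= /eqP; rewrite ?oner_eq0// eq_sym oner_eq0. Qed.

Lemma natr_negb (R : pzRingType) (b : bool) : (~~ b)%:R = 1 - b%:R :> R.
Proof. by case: b; rewrite ?subrr ?subr0. Qed.

Lemma selection_maxP (R : realFieldType) (y : bool -> R) (d : R) :
    d = 0 \/ d = 1 ->
  (y false < y true -> d = 1) /\ (y true < y false -> d = 0) <->
  (forall b : bool, d = b%:R -> y (~~ b) <= y b).
Proof.
move=> d01; split=> [[y_d1 y_d0] b dE|y_le].
  rewrite leNgt; apply/negP => y_lt; case: b dE y_lt => /= dE y_lt.
    by move: (y_d0 y_lt); lra.
  by move: (y_d1 y_lt); lra.
by split=> y_lt; case: d01 => // dE;
  [have := y_le false dE | have := y_le true dE] => /=; lra.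
Qed.

Lemma measurable_fun_bool_family d d' (T : measurableType d)
    (U : measurableType d') (f : bool -> T -> U) :
    (forall b, measurable_fun [set: T] (f b)) ->
  measurable_fun [set: T * bool] (fun x => f x.2 x.1).
Proof.
move=> mf.
rewrite (_ : (fun x => _) = fun x => if x.2 then f true x.1 else f false x.1).
  exact: measurable_fun_if_pair.
by apply/funext => -[x []].
Qed.

Lemma quantile_coupling (R : realType) (I : Type) (m : bool -> R)
    (H : I -> forall b, cumulativeBounded 0 (m b)) :
    (forall b, 0 <= m b) -> m false + m true = 1 ->
  exists (P : probability (measurableTypeR R * bool)%type R)
      (D : {RV P >-> R}) (Y : I -> {RV P >-> R}),
    [/\ forall x, D x = 0 \/ D x = 1,
        forall i (b : bool) y,
          P [set x | Y i x <= y /\ D x = b%:R] = (H i b y)%:E &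
        forall i j (b : bool) x, D x = b%:R ->
          (forall y, H i b y <= H j b y) -> Y j x <= Y i x].
Proof.
move=> mass_ge0 mass1.
pose block b : set R := `]0, m b[%classic.
have mblock b : measurable (block b) by exact: measurable_itv.
have block_mass b : mrestr lebesgue_measure (mblock b) setT = (m b)%:E.
  by rewrite /mrestr setTI lebesgue_measure_itv_bnd// subr0.
have [|P PE] := @bool_mixture_probability _ (measurableTypeR R) R
    (fun b => mrestr lebesgue_measure (mblock b)).
  by rewrite /= !block_mass -EFinD mass1.
pose Y i (x : measurableTypeR R * bool) : R := quantile (H i x.2) x.1.
have mY i : measurable_fun setT (Y i).
  exact: (measurable_fun_bool_family (fun b => measurable_quantile (H i b))).
pose D (x : measurableTypeR R * bool) : R := x.2%:R.
have mD : measurable_fun setT D.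
  exact: (measurable_fun_bool_family (fun b => measurable_cst (b%:R : R))).
exists P, (mfun_Sub (mem_set mD)), (fun i => mfun_Sub (mem_set (mY i))).
split=> [x|i b y|i j b x /natr_bool_inj <- Hij] /=.
- by rewrite /D; case: x.2; [right|left].
- pose E := [set u | quantile (H i b) u <= y].
  have mE : measurable E.
    rewrite -[E]setTI.
    exact: measurable_quantile measurableT _ (measurable_itv `]-oo, y]).
  rewrite (_ : [set x | _] = E `*` [set b]); last first.
    by apply/seteqP; split=> x /= [+ xb];
      rewrite /Y ?(natr_bool_inj xb) /D ?xb.
  by rewrite PE// -(subr0 (H i b y)) -lebesgue_quantile_le.
- exact: quantile_anti.
Qed.

Section random_variable_events.
Context d {T : measurableType d} {R : realType} {P : probability T R}.
Implicit Types X Y Z D : {RV P >-> R}.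

Lemma measurable_eq_event D (b : R) : measurable [set x | D x = b].
Proof. exact: (@measurable_funPTI _ _ _ _ D [set b]). Qed.

Lemma measurable_le_event X (y : \bar R) :
  measurable [set x | ((X x)%:E <= y)%E].
Proof.
rewrite -[X in measurable X]setTI.
by apply: emeasurable_fun_infty_c => //; exact/measurable_EFinP.
Qed.

Lemma measurable_gt_event X (y : \bar R) :
  measurable [set x | (y < (X x)%:E)%E].
Proof.
rewrite -[X in measurable X]setTI.
by apply: emeasurable_fun_o_infty => //; exact/measurable_EFinP.
Qed.

Definition observed_outcome (Z : bool -> {RV P >-> R}) D : {RV P >-> R} :=
  Z true * D + Z false * (1 - D).

Lemma observed_outcomeE (Z : bool -> {RV P >-> R}) D (b : bool) x :
  D x = b%:R -> observed_outcome Z D x = Z b x.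
Proof.
move=> Dx; rewrite -[LHS]/(Z true x * D x + Z false x * (1 - D x)) Dx.
by case: b {Dx} => /=; lra.
Qed.

Lemma probability_binary_split D (A : set T) :
    (forall x, D x = 0 \/ D x = 1) -> measurable A ->
  P A = (P (A `&` [set x | D x = 0%R]) + P (A `&` [set x | D x = 1%R]))%E.
Proof.
move=> D01 mA; rewrite (measureDI _ mA (measurable_eq_event D 1)).
congr (P _ + _)%E; apply/seteqP; split=> x [Ax Dx]; split=> //.
  by case: (D01 x).
by rewrite /= Dx; apply/eqP; rewrite eq_sym oner_eq0.
Qed.

Lemma Fext_cdf X (y : \bar R) : Fext (cdf X) y = P [set x | ((X x)%:E <= y)%E].
Proof.
case: y => [r| |] /=.
- by [].
- rewrite (cvg_lim _ (cvg_cdfy1 X))// -(probability_setT P); congr (P _).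
  by apply/seteqP; split=> x //= _; rewrite leey.
- rewrite (cvg_lim _ (cvg_cdfNy0 X))// -(measure0 P); congr (P _).
  by apply/seteqP; split.
Qed.

Lemma Fext_cdfB X (y1 y2 : \bar R) : (y1 <= y2)%E ->
  (Fext (cdf X) y2 - Fext (cdf X) y1 =
   P [set x | y1 < (X x)%:E /\ (X x)%:E <= y2])%E.
Proof.
move=> y12; have mX := measurable_le_event X.
have X_sub : [set x | ((X x)%:E <= y1)%E] `<=` [set x | ((X x)%:E <= y2)%E].
  by move=> x /= /le_trans; apply.
rewrite !Fext_cdf -[X in (_ - P X)%E](setIidr X_sub) -measureD//; last first.
  by rewrite ltey_eq fin_num_measure.
congr (P _); apply/seteqP; split=> x /= [].
  by move=> Xy2 /negP; rewrite -ltNge.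
by move=> y1X Xy2; split=> //; apply/negP; rewrite -ltNge.
Qed.

Lemma ineq_star_potential_outcome Y D (Z : bool -> {RV P >-> R}) :
    (forall x (b : bool), D x = b%:R -> Y x = Z b x) ->
    {ae P, forall x, forall b : bool, D x = b%:R -> Z (~~ b) x <= Z b x} ->
  forall (b : bool) (y1 y2 : \bar R), (y1 < y2)%E ->
    ineq_star P Y D b%:R (cdf (Z b)) y1 y2.
Proof.
move=> YZ Zmax b y1 y2 y12.
rewrite /ineq_star (Fext_cdfB _ (ltW y12)) -natr_negb.
have m_le X := measurable_le_event X; have m_gt X := measurable_gt_event X.
have m_eq := measurable_eq_event D.
set chosen := [set x | _ /\ _ /\ _]; set other := [set x | _ /\ D x = _].
set Z_itv := [set x | _ /\ _].
have m_chosen : measurable chosen.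
  exact: measurableI (m_gt Y y1) (measurableI _ _ (m_le Y y2) (m_eq b%:R)).
have m_other : measurable other.
  exact: measurableI (m_le Y y2) (m_eq (~~ b)%:R).
have m_itv : measurable Z_itv.
  exact: measurableI (m_gt (Z b) y1) (m_le (Z b) y2).
have chosen_itv : chosen `<=` Z_itv.
  by move=> x [y1Y [Yy2 /YZ YZx]]; rewrite /Z_itv/= -YZx.
have [y1N|y1N] := eqVneq y1 -oo%E; last first.
  by rewrite mul0e adde0; apply: le_measure; rewrite ?inE.
rewrite mul1e -measureU//; last first.
  apply/seteqP; split=> // x [[_ [_ Db]] [_]].
  by rewrite Db => /natr_bool_inj/(congr1 (addb b)); rewrite addbN addbb.
apply: le_measure_ae => //; first exact: measurableU.
apply: filterS Zmax => x Zmax [/chosen_itv//|[Yy2 Dx]].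
split; first by rewrite y1N ltNyr.
rewrite (le_trans _ Yy2)// lee_fin (YZ _ _ Dx).
by rewrite -[X in Z X x <= _]negbK; exact: Zmax.
Qed.

End random_variable_events.

Lemma binary_law_eq_rays d d' (T : measurableType d) (T' : measurableType d')
    (R : realType) (P : probability T R) (P' : probability T' R)
    (Y D : {RV P >-> R}) (Y' D' : {RV P' >-> R}) :
    (forall x, D x = 0 \/ D x = 1) -> (forall x, D' x = 0 \/ D' x = 1) ->
    (forall (b : bool) y, P' [set x | Y' x <= y /\ D' x = b%:R] =
                          P [set x | Y x <= y /\ D x = b%:R]) ->
  forall A : set R, measurable A -> forall b,
    P' [set x | A (Y' x) /\ D' x = b] = P [set x | A (Y x) /\ D x = b].
Proof.
move=> D01 D'01 rays A mA b.
have law_bool (c : bool) : P' [set x | A (Y' x) /\ D' x = c%:R] =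
                           P [set x | A (Y x) /\ D x = c%:R].
  by apply: (law_eq_rays _ _ (rays c)) => //; exact: measurable_eq_event.
have [->|b0] := eqVneq b 0; first exact: law_bool false.
have [->|b1] := eqVneq b 1; first exact: law_bool true.
have off_range (r : R) : r = 0 \/ r = 1 -> r <> b.
  by move=> [] -> /esym/eqP; apply/negP.
rewrite (_ : [set x | A (Y' x) /\ _] = set0); last first.
  by rewrite -subset0 => x [_ /off_range]; apply.
rewrite (_ : [set x | A (Y x) /\ _] = set0) ?measure0//.
by rewrite -subset0 => x [_ /off_range]; apply.
Qed.

Section joint_cdf.
Context d {T : measurableType d} {R : realType} {P : probability T R}.
Implicit Types (Y D : {RV P >-> R}) (b : R) (F : R -> R).

Definition joint_cdf Y D b y := fine (P [set x | Y x <= y /\ D x = b]).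

Lemma measurable_joint_event Y D b y : measurable [set x | Y x <= y /\ D x = b].
Proof.
apply: measurableI; last exact: measurable_eq_event.
exact: (measurable_le_event Y y%:E).
Qed.

Lemma joint_cdfE Y D b y :
  P [set x | Y x <= y /\ D x = b] = (joint_cdf Y D b y)%:E.
Proof. by rewrite fineK// fin_num_measure//; exact: measurable_joint_event. Qed.

Section cumulative.
Variables (Y D : {RV P >-> R}) (b : R).

Let cvg_joint_cdf (F : set_system R) {FF : Filter F} (B : set T) :
    measurable B ->
    (\forall y \near F,
       [set x | Y x <= y] `<=` B \/ B `<=` [set x | Y x <= y]) ->
    cdf Y y @[y --> F] --> P B ->
  joint_cdf Y D b @ F --> fine (P (B `&` [set x | D x = b])).
Proof.
move=> mB nested cdfY.
apply: (@cvg_fine_measureI _ _ _ P _ _ _ (fun y => [set x | Y x <= y])) => //.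
- by move=> y; exact: (measurable_le_event Y y%:E).
- exact: measurable_eq_event.
- by apply: fine_cvg; rewrite fineK ?fin_num_measure.
Qed.

Let nondecreasing_joint_cdf : nondecreasing (joint_cdf Y D b).
Proof.
move=> y z yz; rewrite -lee_fin -!joint_cdfE; apply: le_measure; rewrite ?inE;
  [exact: measurable_joint_event..|].
by move=> x [/le_trans Yy Dx]; split=> //; exact: Yy.
Qed.

Let right_continuous_joint_cdf : right_continuous (joint_cdf Y D b).
Proof.
move=> y; apply: cvg_joint_cdf.
- exact: (measurable_le_event Y y%:E).
- near=> z; right=> x /= /le_trans; apply.
  by near: z; exact: nbhs_right_ge.
- exact: cdf_right_continuous.
Unshelve. all: by end_near. Qed.

Let joint_cdfNy : joint_cdf Y D b @ -oo --> (0 : R).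
Proof.
rewrite [X in _ --> X](_ : _ = fine (P (set0 `&` [set x | D x = b]))).
  apply: cvg_joint_cdf => //; first by near=> y; right.
  by rewrite measure0; exact: cvg_cdfNy0.
by rewrite set0I measure0.
Unshelve. all: by end_near. Qed.

Let joint_cdfy : joint_cdf Y D b @ +oo --> fine (P [set x | D x = b]).
Proof.
rewrite -[X in P X]setTI; apply: cvg_joint_cdf => //; first by near=> y; left.
by rewrite probability_setT; exact: cvg_cdfy1.
Unshelve. all: by end_near. Qed.

HB.instance Definition _ := isCumulative.Build R _ R (joint_cdf Y D b)
  nondecreasing_joint_cdf right_continuous_joint_cdf.

HB.instance Definition _ := isCumulativeBounded.Build R 0
  (fine (P [set x | D x = b])) (joint_cdf Y D b) joint_cdfNy joint_cdfy.

End cumulative.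

Lemma joint_cdfB Y D b y z : y <= z ->
  P [set x | y < Y x /\ Y x <= z /\ D x = b] =
  (joint_cdf Y D b z - joint_cdf Y D b y)%:E.
Proof.
move=> yz; have mJ := measurable_joint_event Y D b.
have J_sub : [set x | Y x <= y /\ D x = b] `<=` [set x | Y x <= z /\ D x = b].
  by move=> x [/le_trans Yy Dx]; split=> //; exact: Yy.
rewrite EFinB -!joint_cdfE -[X in (_ - P X)%E](setIidr J_sub) -measureD//.
  congr (P _); apply/seteqP; split=> x /=.
    by move=> [yY [Yz Dx]]; split=> // -[]; rewrite leNgt yY.
  move=> [[Yz Dx] nYy]; split=> //.
  by rewrite ltNge; apply/negP => Yy; exact: nYy.
by rewrite ltey_eq fin_num_measure.
Qed.

Lemma ineq_star_incr Y D b F y z : y <= z ->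
    ineq_star P Y D b (EFin \o F) y%:E z%:E ->
  joint_cdf Y D b z - joint_cdf Y D b y <= F z - F y.
Proof.
move=> yz; rewrite /ineq_star /= mul0e adde0 -EFinB -lee_fin.
by rewrite -joint_cdfB.
Qed.

Lemma ineq_star_Ny Y D b F y : F @ -oo --> (0 : R) ->
    ineq_star P Y D b (EFin \o F) -oo%E y%:E ->
  joint_cdf Y D b y + joint_cdf Y D (1 - b) y <= F y.
Proof.
move=> F0; rewrite /ineq_star /= mul1e (_ : lim _ = 0%E); last first.
  by apply: cvg_lim => //; apply: cvg_EFin => //; exact: nearW.
rewrite (_ : [set x | _ /\ _ /\ _] = [set x | Y x <= y /\ D x = b]).
  rewrite (_ : [set x | (_ <= _)%E /\ _] = [set x | Y x <= y /\ D x = 1 - b]).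
    by rewrite !joint_cdfE sube0 -EFinD lee_fin.
  by apply/seteqP; split=> x /=; rewrite lee_fin.
apply/seteqP; split=> x /=; rewrite lee_fin; first by case.
by move=> YD; rewrite ltNyr.
Qed.

End joint_cdf.

Section ineq_star_coupling.
Context d {T : measurableType d} {R : realType} {P : probability T R}.
Variables (Y D : {RV P >-> R}) (F : bool -> R -> R).
Hypothesis D01 : forall x, D x = 0 \/ D x = 1.
Hypothesis F_right_continuous : forall a, right_continuous (F a).
Hypothesis FNy : forall a, F a @ -oo --> (0 : R).
Hypothesis Fy : forall a, F a @ +oo --> (1 : R).
Hypothesis star : forall (a : bool) (y1 y2 : \bar R), (y1 < y2)%E ->
  ineq_star P Y D a%:R (EFin \o F a) y1 y2.

Let mass (b : bool) := fine (P [set x | D x = b%:R]).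

Let mass1 : mass false + mass true = 1.
Proof.
have mD b := measurable_eq_event D b.
apply: EFin_inj; rewrite EFinD !fineK ?fin_num_measure// -(probability_setT P).
by rewrite (probability_binary_split D01 measurableT) !setTI.
Qed.

(* The only possible value of [P(Y_a <= y, D = b)] if [Y_a] has distribution
   function [F a]. *)
Definition potential_joint_cdf (a b : bool) (y : R) :=
  if a == b then joint_cdf Y D b%:R y else F a y - joint_cdf Y D a%:R y.

Let nondecreasing_potential_joint_cdf a b :
  nondecreasing (potential_joint_cdf a b).
Proof.
rewrite /potential_joint_cdf; case: eqP => [_|_].
  exact: cumulative_is_nondecreasing.
move=> y z; rewrite le_eqVlt => /predU1P[->//|yz].
have := ineq_star_incr (ltW yz) (star a (y1 := y%:E) (y2 := z%:E) yz).
lra.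
Qed.

Let right_continuous_potential_joint_cdf a b :
  right_continuous (potential_joint_cdf a b).
Proof.
rewrite /potential_joint_cdf; case: eqP => [_|_] y.
  exact: cumulative_is_right_continuous.
by apply: cvgB => //; exact: cumulative_is_right_continuous.
Qed.

Let potential_joint_cdfNy a b : potential_joint_cdf a b @ -oo --> (0 : R).
Proof.
rewrite /potential_joint_cdf; case: eqP => [_|_]; first exact: cumulativeNy.
by rewrite -[X in _ --> X](subr0 0); apply: cvgB => //; exact: cumulativeNy.
Qed.

Let potential_joint_cdfy a b : potential_joint_cdf a b @ +oo --> mass b.
Proof.
rewrite /potential_joint_cdf; case: eqP => [_|/eqP ab].
  exact: cumulativey.
have -> : mass b = 1 - mass a.
  by move: ab mass1; case: a; case: b => //= _; lra.
by apply: cvgB => //; exact: cumulativey.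
Qed.

HB.instance Definition _ (a b : bool) :=
  isCumulative.Build R _ R (potential_joint_cdf a b)
    (@nondecreasing_potential_joint_cdf a b)
    (@right_continuous_potential_joint_cdf a b).

HB.instance Definition _ (a b : bool) :=
  isCumulativeBounded.Build R 0 (mass b) (potential_joint_cdf a b)
    (@potential_joint_cdfNy a b) (@potential_joint_cdfy a b).

Let potential_joint_cdf_le b y :
  potential_joint_cdf b b y <= potential_joint_cdf (~~ b) b y.
Proof.
rewrite /potential_joint_cdf eqxx; have -> : (~~ b == b) = false by case: b.
have := ineq_star_Ny (FNy (~~ b)) (star (~~ b) (ltNyr y)).
by rewrite -natr_negb negbK; lra.
Qed.

Lemma ineq_star_coupling :
  exists (P' : probability (measurableTypeR R * bool)%type R)
    (D' : {RV P' >-> R}) (Y' : bool -> {RV P' >-> R}),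
  [/\ forall x, D' x = 0 \/ D' x = 1,
      forall a y, cdf (Y' a) y = (F a y)%:E,
      forall A : set R, measurable A -> forall b : R,
        P' [set x | A (observed_outcome Y' D' x) /\ D' x = b] =
        P [set x | A (Y x) /\ D x = b] &
      forall (b : bool) x, D' x = b%:R -> Y' (~~ b) x <= Y' b x].
Proof.
have mass_ge0 b : 0 <= mass b by exact: fine_ge0.
have [P' [D' [Y' [D'01 Y'E Y'_le]]]] :=
  @quantile_coupling R bool mass (fun a b => potential_joint_cdf a b)
    mass_ge0 mass1.
exists P', D', Y'; split=> // [a y||b x D'x].
- have mY' : measurable [set x | Y' a x <= y].
    exact: (measurable_le_event (Y' a) y%:E).
  rewrite [LHS](probability_binary_split D'01 mY') (Y'E a false) (Y'E a true).
  rewrite -EFinD; congr EFin.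
  by case: a {mY'}; rewrite /= /potential_joint_cdf/=; lra.
- apply: binary_law_eq_rays => // b y.
  transitivity (P' [set x | Y' b x <= y /\ D' x = b%:R]).
    congr (P' _); apply/seteqP; split=> x [Yy D'x]; split=> //.
      by rewrite -(observed_outcomeE Y' D'x).
    by move: Yy; rewrite -(observed_outcomeE Y' D'x).
  by rewrite Y'E joint_cdfE /= /potential_joint_cdf eqxx.
- by apply: (Y'_le _ _ _ _ D'x); exact: potential_joint_cdf_le.
Qed.

End ineq_star_coupling.

Theorem theorem4 (R : realType) :
  (* (1) *)
  (forall (dT : measure_display) (T : measurableType dT) (P : probability T R)
     (Y0 Y1 Y D : {RV P >-> R}),
     (forall x, D x = 0 \/ D x = 1) ->
     (forall x, Y x = Y1 x * D x + Y0 x * (1 - D x)) ->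
     {ae P, forall x, (Y0 x < Y1 x -> D x = 1) /\ (Y1 x < Y0 x -> D x = 0)} ->
     forall (dd : R), (dd = 0 \/ dd = 1) ->
     forall y1 y2 : \bar R, (y1 < y2)%E ->
       ineq_star P Y D dd (cdf (if dd == 0 then Y0 else Y1)) y1 y2)
  /\
  (* (2) *)
  (forall (dT : measure_display) (T : measurableType dT) (P : probability T R)
     (Y D : {RV P >-> R}) (F0 F1 : R -> R),
     (forall x, D x = 0 \/ D x = 1) ->
     right_continuous F0 -> right_continuous F1 ->
     F0 @ -oo --> (0 : R) -> F0 @ +oo --> (1 : R) ->
     F1 @ -oo --> (0 : R) -> F1 @ +oo --> (1 : R) ->
     (forall (dd : R), (dd = 0 \/ dd = 1) ->
       forall y1 y2 : \bar R, (y1 < y2)%E ->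
         ineq_star P Y D dd
           (fun r => (if dd == 0 then F0 r else F1 r)%:E) y1 y2) ->
     exists (dT' : measure_display) (T' : measurableType dT')
            (P' : probability T' R) (Yt Dt Y0 Y1 : {RV P' >-> R}),
       (forall x, Dt x = 0 \/ Dt x = 1) /\
       (forall (A : set R), measurable A -> forall b : R,
          P' [set x | A (Yt x) /\ Dt x = b] = P [set x | A (Y x) /\ D x = b]) /\
       (forall y, cdf Y0 y = (F0 y)%:E) /\
       (forall y, cdf Y1 y = (F1 y)%:E) /\
       (forall x, Yt x = Y1 x * Dt x + Y0 x * (1 - Dt x)) /\
       {ae P', forall x, (Y0 x < Y1 x -> Dt x = 1) /\ (Y1 x < Y0 x -> Dt x = 0)}).
Proof.
split=> [dT T P Y0 Y1 Y D D01 YE selection a a01 y1 y2 y12|].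
  pose Z (b : bool) := if b then Y1 else Y0.
  have [b aE] : exists b : bool, a = b%:R.
    by case: a01 => ->; [exists false|exists true].
  have -> : (if a == 0 then Y0 else Y1) = Z b.
    by rewrite aE; case: b {aE}; rewrite ?oner_eq0 ?eqxx.
  rewrite aE; apply: ineq_star_potential_outcome => // [x c Dx|].
    by rewrite -(observed_outcomeE Z Dx).
  by apply: filterS selection => x /(selection_maxP (fun b => Z b x) (D01 x)).
move=> dT T P Y D F0 F1 D01 rc0 rc1 F0N F0y F1N F1y star.
pose F (b : bool) := if b then F1 else F0.
have starF (b : bool) (y1 y2 : \bar R) :
    (y1 < y2)%E -> ineq_star P Y D b%:R (EFin \o F b) y1 y2.
  case: b => y12.
    by have := star 1 (or_intror erefl) _ _ y12; rewrite oner_eq0.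
  by have := star 0 (or_introl erefl) _ _ y12; rewrite eqxx.
have [||| P' [D' [Y' [D'01 cdfY' law Y'_max]]]] :=
  ineq_star_coupling D01 _ _ _ starF; try by case.
exists _, _, P', (observed_outcome Y' D'), D', (Y' false), (Y' true).
do 5?split=> //; apply: aeW => x.
by apply/(selection_maxP (fun b => Y' b x) (D'01 x)) => b; exact: Y'_max.
Qed.
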